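(* Let the control matrix $Z_u\in\mathfrak{sl}_2(\mathbb{R})$ be constant in time, let $g(0)=I_2$, $X(0)=X_0$ with $\langle Z_u,X_0\rangle\neq0$, and put $P=Z_u/\langle Z_u,X_0\rangle$. Then the solution of the state-costate equations $$g'=gX,\quad X'=\frac{[Z_u,X]}{\langle Z_u,X\rangle},\quad\Lambda_1'=[\Lambda_1,X],$$ $$\Lambda_R'=\frac{[Z_u,\Lambda_R]}{\langle Z_u,X\rangle}-\frac{\langle\Lambda_R,Z_u\rangle}{\langle X,Z_u\rangle}\frac{[Z_u,X]}{\langle Z_u,X\rangle}+\left[-\Lambda_1+\tfrac32\lambda_{cost}J,X\right]$$ with initial values $\Lambda_1(0),\Lambda_R(0)\in\mathfrak{sl}_2(\mathbb{R})$ is $$g(t)=\exp(t(X_0+P))\exp(-tP),\quad X(t)=\mathrm{Ad}_{\exp(tP)}X_0,\quad\Lambda_1(t)=g(t)^{-1}\Lambda_1(0)g(t),\quad\Lambda_R(t)=\mathrm{Ad}_{\exp(tP)}S(t),$$ where $$S(t)=\Lambda_R(0)-[L_P(t)+\ell(t)P,X_0],\qquad\ell(t)=\int_0^t\langle P,\Lambda_R(0)-[L_P(s),X_0]\rangle\,ds,$$ $$L_P(t)=\int_0^t\left(\mathrm{Ad}_{\exp(-(X_0+P)s)}\Lambda_1(0)-\tfrac32\lambda_{cost}\,\mathrm{Ad}_{\exp(-Ps)}J\right)ds.$$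
   Context: $\langle A,B\rangle=\mathrm{trace}(AB)$ and $[A,B]=AB-BA$ for $A,B\in\mathfrak{sl}_2(\mathbb{R})$; $\mathrm{Ad}_hY=hYh^{-1}$; $J=\begin{pmatrix}0&-1\\1&0\end{pmatrix}$; $\lambda_{cost}\in\mathbb{R}_{\le0}$ is a constant; $g(t)\in\mathrm{SL}_2(\mathbb{R})$ and $X(t),\Lambda_1(t),\Lambda_R(t)\in\mathfrak{sl}_2(\mathbb{R})$. *)

(* Defs.v *)
From HB Require Import structures.
From mathcomp Require Import all_boot all_order all_algebra.
From mathcomp Require Import all_classical all_reals all_analysis.

Set Implicit Arguments.
Unset Strict Implicit.
Unset Printing Implicit Defensive.

Import Order.TTheory GRing.Theory Num.Theory.
Import numFieldNormedType.Exports.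

Local Open Scope classical_set_scope.
Local Open Scope ring_scope.

Definition sl2 (R : realType) : set 'M[R]_2 := [set A | \tr A = 0].

Definition SL2 (R : realType) : set 'M[R]_2 := [set A | \det A = 1].

Definition trform (R : realType) (A B : 'M[R]_2) : R := \tr (A *m B).

Definition lie (R : realType) (A B : 'M[R]_2) : 'M[R]_2 :=
  A *m B - B *m A.

Definition Ad (R : realType) (h Y : 'M[R]_2) : 'M[R]_2 :=
  h *m Y *m invmx h.

(* The rows of J are (0, -1) and (1, 0). *)
Definition J (R : realType) : 'M[R]_2 := delta_mx 1 0 - delta_mx 0 1.

(* The limit is taken for the normed topology of 'M[R]_2, like expR in R. *)
Definition expmx (R : realType) (A : 'M[R]_2) : 'M[R]_2 :=
  limn (series (fun k : nat => (k`!%:R)^-1 *: A ^+ k)).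

(* The integral from 0 to t, with the usual sign convention when t < 0. *)
Definition int0 (R : realType) (f : R -> R) (t : R) : R :=
  if 0 <= t then \int[lebesgue_measure]_(s in `[0, t]) f s
  else - \int[lebesgue_measure]_(s in `[t, 0]) f s.

Definition int0mx (R : realType) (F : R -> 'M[R]_2) (t : R) : 'M[R]_2 :=
  \matrix_(i, j) int0 (fun s => F s i j) t.

(* Solutions on an interval I of the initial value problem for the state and
   the costate with constant control matrix Zu.  The differential equations
   are imposed in the interior of I; at an endpoint belonging to I only
   continuity is required.  The denominator must not vanish, since division
   by 0 is total in MathComp. *)
Record state_costate_solution (R : realType) (lcost : R) (Zu : 'M[R]_2)
    (X0 L10 LR0 : 'M[R]_2) (I : interval R)
    (g X L1 LR : R -> 'M[R]_2) : Prop := StateCostateSolution {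
  scs_g_SL2 : forall t : R, t \in I -> SL2 (g t);
  scs_X_sl2 : forall t : R, t \in I -> sl2 (X t);
  scs_L1_sl2 : forall t : R, t \in I -> sl2 (L1 t);
  scs_LR_sl2 : forall t : R, t \in I -> sl2 (LR t);
  scs_denom : forall t : R, t \in I -> trform Zu (X t) != 0;
  scs_g_cont : {within [set` I], continuous g};
  scs_X_cont : {within [set` I], continuous X};
  scs_L1_cont : {within [set` I], continuous L1};
  scs_LR_cont : {within [set` I], continuous LR};
  scs_g_ode : forall t : R, [set` I]° t ->
    is_derive t 1 g (g t *m X t);
  scs_X_ode : forall t : R, [set` I]° t ->
    is_derive t 1 X ((trform Zu (X t))^-1 *: lie Zu (X t));
  scs_L1_ode : forall t : R, [set` I]° t ->
    is_derive t 1 L1 (lie (L1 t) (X t));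
  scs_LR_ode : forall t : R, [set` I]° t ->
    is_derive t 1 LR
      ((trform Zu (X t))^-1 *: lie Zu (LR t)
       - (trform (LR t) Zu / trform (X t) Zu)
           *: ((trform Zu (X t))^-1 *: lie Zu (X t))
       + lie (- L1 t + (3 / 2 * lcost) *: J R) (X t));
  scs_g_init : g 0 = 1%:M;
  scs_X_init : X 0 = X0;
  scs_L1_init : L1 0 = L10;
  scs_LR_init : LR 0 = LR0
}.

(* Main.v *)
Require Import Defs.
From HB Require Import structures.
From mathcomp Require Import all_boot all_order all_algebra.
From mathcomp Require Import all_classical all_reals all_analysis.
From mathcomp Require Import ring lra.

(** Conjugation by [exp(tP)] straightens the system.  Everything rests on
    [d/dt Ad_{exp(tA)} F = Ad_{exp(tA)} ([A, F] + F')] ([derivative_on_Ad]).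

    Existence.  [X = Ad_{exp(tP)} X0] satisfies [X' = [P, X]], and
    [<Zu, X>] keeps its initial value because [P] is fixed by [Ad_{exp(tP)}];
    hence [[Zu, X] / <Zu, X> = [P, X]].  The product
    [g = exp(t(X0 + P)) exp(-tP)] satisfies [g' = gX] since the two terms in
    [P] cancel, and [Lambda_1] is carried along by conjugation with [g].
    Writing [Lambda_R = Ad_{exp(tP)} S], the equation for [Lambda_R] becomes
    [S' = - [L_P' + <P, S> P, X0]], where [L_P'] is the pull-back of
    [Lambda_1 - (3/2) lambda_cost J].  Since [<P, [P, X0]> = 0], the scalar
    [<P, S>] does not see the term [ell P] in [S], so it is an explicit function
    of [L_P] and [ell] is its primitive ([trform_S], [derivative_on_S]).

    Uniqueness.  Along an arbitrary solution on an interval each unknown is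
    turned into a conserved quantity, and a function that is continuous on the
    interval with zero derivative in its interior is constant.  First [<Zu, X>]
    is conserved, since [<Zu, [Zu, X]> = 0], which linearizes the equation of
    [X]; then [Ad_{exp(-tP)} X], [G g^-1] (for a second solution [G] of
    [G' = GX]) and [g Lambda_1 g^-1] are conserved.  For the difference [Q] of
    two candidates for [Lambda_R], [Q' = [P, Q] - <P, Q> [P, X]]; pairing with
    [P] shows that [<P, Q>] is conserved, so it stays 0, and [Q' = [P, Q]] gives
    [Q = 0]
    ([LR_flow_unique]). *)

Set Implicit Arguments.
Unset Strict Implicit.
Unset Printing Implicit Defensive.

Import Order.TTheory GRing.Theory Num.Theory.
Import numFieldNormedType.Exports.

Local Open Scope classical_set_scope.
Local Open Scope ring_scope.

(** * Limits and derivatives of matrix-valued functions *)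

Lemma cvg_mxP (R : realType) (m n : nat) (T : Type) (F : set_system T)
    (FF : Filter F) (M : T -> 'M[R]_(m, n)) (L : 'M[R]_(m, n)) :
  M @ F --> L <-> forall i j, (fun x => M x i j) @ F --> L i j.
Proof.
split=> [ML i j|ML].
  exact: (cvg_comp _ _ ML (@coord_continuous R m n i j L)).
apply/cvgrPdist_le => /= e e0.
near=> x.
rewrite [leLHS]/Num.Def.normr/= mx_normrE (bigmax_le _ (ltW e0))//= => i _.
rewrite !mxE.
move: i; near: x; apply: filter_forall => /= i.
exact: ((cvgrPdist_le _ _).1 (ML i.1 i.2)).
Unshelve. all: by end_near. Qed.

Lemma cvg_mulmx (R : realType) (m n p : nat) (T : Type) (F : set_system T)
    (FF : Filter F) (M : T -> 'M[R]_(m, n)) (N : T -> 'M[R]_(n, p))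
    (A : 'M[R]_(m, n)) (B : 'M[R]_(n, p)) :
  M @ F --> A -> N @ F --> B -> (fun x => M x *m N x) @ F --> A *m B.
Proof.
move=> /cvg_mxP MA /cvg_mxP NB; apply/cvg_mxP => i j.
under eq_fun do rewrite mxE; rewrite mxE.
apply: cvg_big; first exact: add_continuous.
by move=> k _; apply: cvgM; [exact: MA|exact: NB].
Qed.

Lemma is_derive_mxP (R : realType) (m n : nat) (M : R -> 'M[R]_(m, n))
    (t : R) (D : 'M[R]_(m, n)) :
  is_derive t 1 M D <-> forall i j, is_derive t 1 (fun x => M x i j) (D i j).
Proof.
split=> [dM i j|dM].
  have Md : derivable M t 1 by [].
  have := Md => /derivable_mxP dMij.
  apply: DeriveDef; first exact: dMij.
  by rewrite -(@derive_val _ _ _ _ _ _ _ dM) derive_mx// mxE.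
have Md : derivable M t 1 by apply/derivable_mxP => i j; have [] := dM i j.
apply: DeriveDef => //; apply/matrixP => i j.
by rewrite derive_mx// mxE derive_val.
Qed.

Lemma is_derive_mulmx (R : realType) (m n p : nat) (M : R -> 'M[R]_(m, n))
    (N : R -> 'M[R]_(n, p)) (t : R) (A : 'M[R]_(m, n)) (B : 'M[R]_(n, p)) :
  is_derive t 1 M A -> is_derive t 1 N B ->
  is_derive t 1 (fun x => M x *m N x) (A *m N t + M t *m B).
Proof.
move=> /is_derive_mxP MA /is_derive_mxP NB; apply/is_derive_mxP => i j.
have -> : (fun x => (M x *m N x) i j) =
    \sum_(k < n) ((fun x => M x i k) * (fun x => N x k j)).
  by apply/funext => x; rewrite mxE fct_sumE.
have {}MA k := MA i k.
have {}NB k := NB k j.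
apply: is_derive_eq; rewrite !mxE -big_split/=; apply: eq_bigr => k _.
by rewrite addrC [N t k j *: _]mulrC.
Qed.

(** * The matrix exponential *)

Section expmx_series.
Context (R : realType).
Implicit Types (A B : 'M[R]_2) (t : R).

(** The entries of [expmx (t *: A) *m B] are power series in [t] with these
    coefficients.  The factor [B] makes the family stable under termwise
    differentiation, which replaces [B] by [A *m B]. *)
Definition expmx_coeff A B i j (k : nat) : R := (k`!%:R)^-1 * (A ^+ k *m B) i j.

Lemma expmx_coeff_diffs A B i j :
  pseries_diffs (expmx_coeff A B i j) = expmx_coeff A (A *m B) i j.
Proof.
apply/funext => k; rewrite /pseries_diffs /expmx_coeff mulmxA mulmxE -exprSr.
by rewrite factS natrM invfM mulrA mulVKf// mulrA.
Qed.

Lemma expmx_coeff_le A B : exists2 a : R, 0 <= a & exists2 b : R, 0 <= b &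
  forall i j k, `|(A ^+ k *m B) i j| <= a ^+ k * b.
Proof.
(* The norm is the largest entry, so each product costs the dimension 2. *)
exists (2 * `|A|); first by rewrite mulr_ge0.
exists `|B|; first by [].
move=> i j k; elim: k i j => [|k IH] i j.
  rewrite expr0 mul1mx mul1r [leRHS]/Num.Def.normr/= mx_normrE.
  exact: (le_bigmax _ (fun i => `|B i.1 i.2|) (i, j)).
rewrite exprS -mulmxE -mulmxA mxE (le_trans (ler_norm_sum _ _ _))//.
rewrite (@le_trans _ _ (\sum_(l < 2) `|A| * ((2 * `|A|) ^+ k * `|B|)))//.
  apply: ler_sum => l _; rewrite normrM ler_pM//.
  rewrite [leRHS]/Num.Def.normr/= mx_normrE.
  exact: (le_bigmax _ (fun i => `|A i.1 i.2|) (i, l)).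
rewrite sumr_const card_ord exprS -[leLHS]mulr_natl; lra.
Qed.

(** Domination by the exponential series of a real number. *)
Lemma is_cvg_expmx_coeff A B i j t : cvgn (pseries (expmx_coeff A B i j) t).
Proof.
have [a a0 [b b0 le_ab]] := expmx_coeff_le A B.
apply: normed_cvg.
apply: (@series_le_cvg _ _ (b *: exp_coeff (a * `|t|))) => [n|n|n|].
- exact: normr_ge0.
- by rewrite mulr_ge0// /exp_coeff/= mulr_ge0// exprn_ge0// mulr_ge0.
- rewrite /= /expmx_coeff !normrM [X in X * _ * _]ger0_norm// normrX.
  have -> : (b *: exp_coeff (a * `|t|)) n =
      n`!%:R^-1 * (a ^+ n * b) * `|t| ^+ n.
    by rewrite fctE /exp_coeff /= exprMn /GRing.scale/=; ring.
  by rewrite ler_wpM2r ?exprn_ge0// ler_wpM2l.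
- by apply: is_cvg_seriesZ; exact: is_cvg_series_exp_coeff.
Qed.

Lemma expmx_series_mul A B t i j :
  (fun n => (series (fun k : nat => (k`!%:R)^-1 *: (t *: A) ^+ k) n *m B) i j) =
  pseries (expmx_coeff A B i j) t.
Proof.
apply/funext => n; rewrite /series/= /pseries/=.
rewrite mulmx_suml summxE; apply: eq_bigr => k _.
by rewrite /expmx_coeff exprZn scalerA -scalemxAl mxE mulrAC.
Qed.

Lemma expmx_cvg A :
  series (fun k : nat => (k`!%:R)^-1 *: A ^+ k) @ \oo --> expmx A.
Proof.
suff : cvgn (series (fun k : nat => (k`!%:R)^-1 *: A ^+ k)) by [].
apply/cvg_ex; exists (\matrix_(i, j) limn (pseries (expmx_coeff A 1%:M i j) 1)).
apply/cvg_mxP => i j; rewrite mxE.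
have := @expmx_series_mul A 1%:M 1 i j; rewrite scale1r.
under eq_fun do rewrite mulmx1. 
by move=> ->; exact: is_cvg_expmx_coeff.
Qed.

Lemma expmx_mulE A B t i j :
  (expmx (t *: A) *m B) i j = limn (pseries (expmx_coeff A B i j) t).
Proof.
apply/esym/cvg_lim => //; rewrite -expmx_series_mul.
have : (fun n => series (fun k : nat => (k`!%:R)^-1 *: (t *: A) ^+ k) n *m B)
    @ \oo --> expmx (t *: A) *m B.
  by apply: cvg_mulmx; [exact: expmx_cvg|exact: cvg_cst].
by move=> /cvg_mxP; exact.
Qed.

Lemma is_derive_expmx A t :
  is_derive t 1 (fun s => expmx (s *: A)) (expmx (t *: A) *m A).
Proof.
apply/is_derive_mxP => i j.
have -> : (fun s => expmx (s *: A) i j) =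
    (fun s => limn (pseries (expmx_coeff A 1%:M i j) s)).
  by apply/funext => s; rewrite -expmx_mulE mulmx1.
have := @expmx_coeff_diffs A 1%:M i j; rewrite mulmx1 => dA.
rewrite expmx_mulE -dA.
(* Any radius larger than |t| will do, the series converging everywhere. *)
apply: (@pseries_snd_diffs _ _ (`|t| + 1)); rewrite ?expmx_coeff_diffs;
  try exact: is_cvg_expmx_coeff.
by rewrite [ltRHS]ger0_norm ?addr_ge0// ltrDl.
Qed.

Lemma expmx0 : expmx (0 : 'M[R]_2) = 1%:M.
Proof.
have S1 n :
    series (fun k : nat => (k`!%:R)^-1 *: (0 : 'M[R]_2) ^+ k) n.+1 = 1%:M.
  rewrite /series/= big_nat_recl// expr0 fact0 invr1 scale1r.
  by rewrite big1 ?addr0// => i _; rewrite exprS mul0r scaler0.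
apply: cvg_lim => //; rewrite -cvg_shiftS; under eq_fun do rewrite S1.
exact: cvg_cst.
Qed.

Lemma expmx_comm A B t :
  A *m B = B *m A -> expmx (t *: A) *m B = B *m expmx (t *: A).
Proof.
move=> AB; pose S n := series (fun k : nat => (k`!%:R)^-1 *: (t *: A) ^+ k) n.
have SB n : S n *m B = B *m S n.
  rewrite mulmx_suml mulmx_sumr; apply: eq_bigr => k _.
  rewrite -scalemxAl -scalemxAr; congr (_ *: _).
  elim: k => [|k IH]; first by rewrite expr0 mul1mx mulmx1.
  rewrite exprS -mulmxE -mulmxA IH !mulmxA.
  by rewrite -scalemxAl AB scalemxAr.
have ES : S @ \oo --> expmx (t *: A) by exact: expmx_cvg.
have E1 : (fun n => S n *m B) @ \oo --> expmx (t *: A) *m B.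
  by apply: cvg_mulmx => //; exact: cvg_cst.
have E2 : (fun n => S n *m B) @ \oo --> B *m expmx (t *: A).
  by under eq_fun do rewrite SB; apply: cvg_mulmx => //; exact: cvg_cst.
exact: cvg_unique E1 E2.
Qed.

End expmx_series.

(** * Solving differential equations on an interval *)

(** The sense in which a solution of the initial value problem satisfies its
    differential equations: at an endpoint belonging to the interval only
    continuity is required. *)
Definition derivative_on (R : realType) (V : normedModType R) (I : interval R)
    (F F' : R -> V) : Prop :=
  {within [set` I], continuous F} /\
  forall t : R, [set` I]° t -> is_derive t 1 F (F' t).

Lemma derivative_onT (R : realType) (V : normedModType R) (I : interval R)
    (F F' : R -> V) :
  (forall t : R, is_derive t 1 F (F' t)) -> derivative_on I F F'.
Proof.
move=> dF; split=> [|t _]; last exact: dF.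
by apply: derivable_within_continuous => t _; have [] := dF t.
Qed.

Lemma is_derive_continuous (R : realType) (V : normedModType R)
    (F F' : R -> V) :
  (forall t : R, is_derive t 1 F (F' t)) -> continuous F.
Proof.
move=> dF t; apply/differentiable_continuous/derivable1_diffP.
by have [] := dF t.
Qed.

Lemma derivative_on_eq (R : realType) (V : normedModType R) (I : interval R)
    (F F' G : R -> V) :
  derivative_on I F F' -> {in I, F' =1 G} -> derivative_on I F G.
Proof.
move=> [cF dF] FG; split=> // t It.
by rewrite -FG; [exact: dF|exact: interior_subset It].
Qed.

Lemma derivative_onB (R : realType) (V : normedModType R) (I : interval R)
    (F F' G G' : R -> V) :
  derivative_on I F F' -> derivative_on I G G' ->
  derivative_on I (fun t => F t - G t) (fun t => F' t - G' t).
Proof.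
move=> [cF dF] [cG dG]; split=> [|t It]; first exact: within_continuousB.
by have {}dF := dF t It; have {}dG := dG t It; exact: is_deriveB.
Qed.

Lemma derivative_on_mulmx (R : realType) (m n p : nat) (I : interval R)
    (M M' : R -> 'M[R]_(m, n)) (N N' : R -> 'M[R]_(n, p)) :
  derivative_on I M M' -> derivative_on I N N' ->
  derivative_on I (fun t => M t *m N t) (fun t => M' t *m N t + M t *m N' t).
Proof.
move=> [cM dM] [cN dN]; split=> [x|t It]; last first.
  by apply: is_derive_mulmx; [exact: dM|exact: dN].
by apply: cvg_mulmx; [exact: cM|exact: cN].
Qed.

Lemma derivative_on_cst (R : realType) (V : normedModType R) (I : interval R)
    (A : V) : derivative_on I (fun=> A) (fun=> 0).
Proof. by apply: derivative_onT => t; exact: is_derive_cst. Qed.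

Lemma derivative_on_entry (R : realType) (m n : nat) (I : interval R)
    (M M' : R -> 'M[R]_(m, n)) i j :
  derivative_on I M M' ->
  derivative_on I (fun t => M t i j) (fun t => M' t i j).
Proof.
move=> [cM dM]; split=> [x|t It]; last by have /is_derive_mxP := dM t It.
by have /cvg_mxP := cM x; exact.
Qed.

Lemma derivative_on_trace (R : realType) (n : nat) (I : interval R)
    (M M' : R -> 'M[R]_n) :
  derivative_on I M M' ->
  derivative_on I (fun t => \tr (M t)) (fun t => \tr (M' t)).
Proof.
move=> dM; split=> [x|t It].
  rewrite /mxtrace; apply: cvg_big; first exact: add_continuous.
  by move=> i _; have [cM _] := derivative_on_entry i i dM; exact: cM.
have -> : (fun t => \tr (M t)) = \sum_(i < n) (fun t => M t i i).
  by apply/funext => x; rewrite fct_sumE.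
apply: is_derive_sum => i.
by have [_] := derivative_on_entry i i dM; exact.
Qed.

Lemma derivative_on0 (R : realType) (I : interval R) (f : R -> R) :
  derivative_on I f (fun=> 0) -> {in I &, forall s t, f s = f t}.
Proof.
move=> [cf df].
suff lt_eq s t : s \in I -> t \in I -> s < t -> f s = f t.
  move=> s t sI tI; have [st|ts|->//] := ltgtP s t; first exact: lt_eq.
  by apply/esym/lt_eq.
move=> sI tI st.
have stI : [set` `[s, t]] `<=` [set` I].
  move=> x /=; rewrite in_itv/= => xst.
  exact: (@interval_is_interval _ I s t).
have [|_ _ /eqP] :=
    @MVT_segment _ f (fun=> 0) s t (ltW st) _ (continuous_subspaceW stI cf).
  move=> x xst; apply: df; apply: (interiorS stI).
  by rewrite interior_itv/=.
by rewrite mul0r subr_eq0 => /eqP.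
Qed.

Lemma derivative_on0mx (R : realType) (m n : nat) (I : interval R)
    (M : R -> 'M[R]_(m, n)) :
  derivative_on I M (fun=> 0) -> {in I &, forall s t, M s = M t}.
Proof.
move=> dM s t sI tI; apply/matrixP => i j.
apply: (@derivative_on0 _ I (fun t => M t i j)) => //.
apply: derivative_on_eq (derivative_on_entry i j dM) _.
by move=> x _; rewrite mxE.
Qed.

(** * Integrals from 0 *)

(** Near [t], [int0 f] is the primitive of [f] based at a point [a] to the left
    of both 0 and [t], up to a constant; this covers both signs of [t]. *)
Lemma is_derive_int0 (R : realType) (f : R -> R) (t : R) :
  continuous f -> is_derive t 1 (int0 f) (f t).
Proof.
move=> cf.
have intf a b : lebesgue_measure.-integrable `[a, b] (EFin \o f).
  by apply: continuous_compact_integrable; [exact: segment_compact|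
    exact: continuous_subspaceT].
pose a : R := Num.min 0 t - 1.
have a0 : a < 0 by rewrite ltrBlDr add0r gt_min ltr01.
have ta : a < t by rewrite ltrBlDr gt_min ltrDl ltr01 orbT.
pose F x := \int[lebesgue_measure]_(s in `[a, x]) f s.
have [|Fd F'] := @continuous_FTC1_closed _ f a t (t + 1) _ (intf _ _) ta (cf t).
  by rewrite ltrDl.
have dF : is_derive t 1 F (f t).
  by apply: DeriveDef => //; rewrite -derive1E F'.
have FB x y : a <= x -> x <= y ->
    F y - F x = \int[lebesgue_measure]_(s in `[x, y]) f s.
  move=> ax xy; rewrite /F Rintegral_itvB//= ?bnd_simp//.
  rewrite Rintegral_itv_obnd_cbnd//; apply: integrableS (intf x y) => //.
  by apply: subset_itvr; rewrite bnd_simp.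
apply: (@near_eq_is_derive _ _ _ (F - cst (F 0))); last first.
  by apply: is_derive_eq; rewrite subr0.
near=> x.
have ax : a < x by near: x; exact: lt_nbhsr.
rewrite !fctE /int0; case: leP => [x0|x0]; first by rewrite FB// ltW.
by rewrite -FB ?opprB// ltW.
Unshelve. all: by end_near. Qed.

Lemma int00 (R : realType) (f : R -> R) : int0 f 0 = 0.
Proof. by rewrite /int0 lexx set_itv1 Rintegral_set1. Qed.

Lemma is_derive_int0mx (R : realType) (F : R -> 'M[R]_2) (t : R) :
  continuous F -> is_derive t 1 (int0mx F) (F t).
Proof.
move=> cF; apply/is_derive_mxP => i j.
have -> : (fun x => int0mx F x i j) = int0 (fun s => F s i j).
  by apply/funext => x; rewrite mxE.
by apply: is_derive_int0 => s; have /cvg_mxP := cF s; exact.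
Qed.

Lemma int0mx0 (R : realType) (F : R -> 'M[R]_2) : int0mx F 0 = 0.
Proof. by apply/matrixP => i j; rewrite !mxE int00. Qed.

(** * One-parameter groups *)

Section expmx_group.
Context (R : realType).
Implicit Types (A B : 'M[R]_2) (I : interval R) (t : R).

Lemma derivative_on_line (V : normedModType R) (F F' : R -> V) :
  derivative_on `]-oo, +oo[ F F' -> forall t, is_derive t 1 F (F' t).
Proof. by move=> [_ dF] t; apply: dF; rewrite set_itvNyy interiorT. Qed.

Lemma derivative_on_expmx I A :
  derivative_on I (fun t => expmx (t *: A)) (fun t => expmx (t *: A) *m A).
Proof. by apply: derivative_onT => t; exact: is_derive_expmx. Qed.

Lemma derivative_on_expmxN I A :
  derivative_on I (fun t => expmx (- t *: A))
    (fun t => - (expmx (- t *: A) *m A)).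
Proof.
have -> : (fun t => expmx (- t *: A)) = (fun t => expmx (t *: (- A))).
  by apply/funext => t; rewrite scaleNr scalerN.
apply: derivative_on_eq (derivative_on_expmx I (- A)) _ => t _.
by rewrite mulmxN scalerN scaleNr.
Qed.

Lemma mul_expmxNx A t : expmx (- t *: A) *m expmx (t *: A) = 1%:M.
Proof.
have /(@derivative_on0mx R 2 2 `]-oo, +oo[) E : derivative_on `]-oo, +oo[
    (fun t => expmx (- t *: A) *m expmx (t *: A)) (fun=> 0).
  apply: derivative_on_eq (derivative_on_mulmx (derivative_on_expmxN _ A)
    (derivative_on_expmx _ A)) _ => s _.
  by rewrite mulNmx -mulmxA -expmx_comm// addNr.
rewrite (E t 0) ?in_itv//.
by rewrite oppr0 !scale0r expmx0 mulmx1.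
Qed.

Lemma mul_expmxxN A t : expmx (t *: A) *m expmx (- t *: A) = 1%:M.
Proof. exact/mulmx1C/mul_expmxNx. Qed.

Lemma expmx_unit A t : expmx (t *: A) \in unitmx.
Proof. by have [] := mulmx1_unit (mul_expmxxN A t). Qed.

Lemma invmx_unique A B : A *m B = 1%:M -> invmx A = B.
Proof.
move=> AB; have [uA _] := mulmx1_unit AB.
by rewrite -[RHS](mulKmx uA) AB mulmx1.
Qed.

Lemma invmx_expmx A t : invmx (expmx (t *: A)) = expmx (- t *: A).
Proof. exact/invmx_unique/mul_expmxxN. Qed.

(** Indices of a matrix of size 2 in the normal form 0 or 1, so that [ring] can
    identify the entries. *)
Lemma mx2E A i j :
  A i j = A (if i == 0 then 0 else 1) (if j == 0 then 0 else 1).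
Proof.
by case: i => [[|[|//]]] ?; case: j => [[|[|//]]] ?; congr (A _ _);
  apply/val_inj.
Qed.

Lemma det_mx2 A : \det A = A 0 0 * A 1 1 - A 0 1 * A 1 0.
Proof.
rewrite (expand_det_row _ 0) big_ord_recl big_ord1 /cofactor !det_mx11 !mxE.
rewrite [A _ (lift 0 _)]mx2E [A _ (lift (lift _ _) _)]mx2E.
by rewrite [A 0 (lift _ _)]mx2E /= expr1 mul1r mulN1r mulrN.
Qed.

(** Liouville's formula [(det E)' = tr A * det E] for [E' = E A]. *)
Lemma det_expmx A t : \tr A = 0 -> \det (expmx (t *: A)) = 1.
Proof.
move=> trA; pose E := fun t => expmx (t *: A).
have dE i j (s : R) : is_derive s (1 : R) (fun t => E t i j) ((E s *m A) i j).
  by have /is_derive_mxP := is_derive_expmx A s; exact.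
have ddet : derivative_on `]-oo, +oo[ (fun s => \det (E s)) (fun=> 0).
  apply: derivative_onT => s.
  have -> : (fun s => \det (E s)) =
      (fun t => E t 0 0) * (fun t => E t 1 1) -
      (fun t => E t 0 1) * (fun t => E t 1 0).
    by apply/funext => x; exact: det_mx2.
  have d00 := dE 0 0 s; have d01 := dE 0 1 s.
  have d10 := dE 1 0 s; have d11 := dE 1 1 s.
  apply: is_derive_eq (is_deriveB (is_deriveM d00 d11) (is_deriveM d01 d10)) _.
  have tr2 : A 0 0 = - A 1 1.
    by apply/eqP; rewrite -addr_eq0 -trA /mxtrace big_ord_recl big_ord1;
      rewrite [A (lift _ _) _]mx2E.
  rewrite /GRing.scale/= !mxE !big_ord_recl !big_ord0 !addr0.
  rewrite ![E s _ (lift _ _)]mx2E ![A (lift _ _) _]mx2E/= tr2; ring.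
rewrite -[LHS]/(\det (E t)) (@derivative_on0 _ _ _ ddet t 0) ?in_itv//.
by rewrite /E scale0r expmx0 det1.
Qed.

End expmx_group.

(** * The adjoint action and the trace form *)

Section adjoint.
Context (R : realType).
Implicit Types (h k A B Y : 'M[R]_2) (I : interval R) (a t : R).

Lemma AdD h A B : Ad h (A + B) = Ad h A + Ad h B.
Proof. by rewrite /Ad mulmxDr mulmxDl. Qed.

Lemma AdN h A : Ad h (- A) = - Ad h A.
Proof. by rewrite /Ad mulmxN mulNmx. Qed.

Lemma AdZ h a A : Ad h (a *: A) = a *: Ad h A.
Proof. by rewrite /Ad -scalemxAr -scalemxAl. Qed.

Lemma Ad_lie h A B : h \in unitmx -> Ad h (lie A B) = lie (Ad h A) (Ad h B).
Proof.
move=> uh; rewrite /Ad /lie mulmxBr mulmxBl !mulmxA.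
by rewrite !(mulmxKV uh).
Qed.

Lemma trform_Ad h A B : h \in unitmx -> trform (Ad h A) (Ad h B) = trform A B.
Proof.
move=> uh; rewrite /trform /Ad !mulmxA (mulmxKV uh) mxtrace_mulC.
by rewrite -!mulmxA (mulKmx uh).
Qed.

Lemma tr_Ad h A : h \in unitmx -> \tr (Ad h A) = \tr A.
Proof. by move=> uh; rewrite /Ad mxtrace_mulC (mulKmx uh). Qed.

Lemma Ad_mul h k Y : h \in unitmx -> k \in unitmx ->
  Ad h (Ad k Y) = Ad (h *m k) Y.
Proof.
move=> uh uk; rewrite /Ad.
suff -> : invmx (h *m k) = invmx k *m invmx h by rewrite !mulmxA.
by apply: invmx_unique; rewrite mulmxA (mulmxK uk) mulmxV.
Qed.

Lemma Ad1 Y : Ad 1%:M Y = Y.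
Proof. by rewrite /Ad mul1mx invmx1 mulmx1. Qed.

Lemma Ad_expmx_id A t : Ad (expmx (t *: A)) A = A.
Proof. by rewrite /Ad expmx_comm// mulmxK// expmx_unit. Qed.

Lemma lieDl A B Y : lie (A + B) Y = lie A Y + lie B Y.
Proof. by rewrite /lie mulmxDl mulmxDr opprD addrACA. Qed.

Lemma lieNl A Y : lie (- A) Y = - lie A Y.
Proof. by rewrite /lie mulmxN mulNmx -opprD. Qed.

Lemma lieZl a A Y : lie (a *: A) Y = a *: lie A Y.
Proof. by rewrite /lie -scalemxAl -scalemxAr scalerBr. Qed.

Lemma lieBr A B Y : lie A (B - Y) = lie A B - lie A Y.
Proof. by rewrite /lie mulmxBr mulmxBl !opprD addrACA. Qed.

Lemma trformBr A B Y : trform A (B - Y) = trform A B - trform A Y.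
Proof. by rewrite /trform mulmxBr linearB/=. Qed.

Lemma trformZr A a Y : trform A (a *: Y) = a * trform A Y.
Proof. by rewrite /trform -scalemxAr mxtraceZ. Qed.

Lemma tr_lie A B : \tr (lie A B) = 0.
Proof. by rewrite /lie linearB/= mxtrace_mulC subrr. Qed.

Lemma trform_lie_self A B : trform A (lie A B) = 0.
Proof.
by rewrite /trform /lie mulmxBr linearB/= mxtrace_mulC -mulmxA subrr.
Qed.

Lemma trformC A B : trform A B = trform B A.
Proof. exact: mxtrace_mulC. Qed.

Lemma derivative_on_lie I (F F' : R -> 'M[R]_2) B :
  derivative_on I F F' ->
  derivative_on I (fun t => lie (F t) B) (fun t => lie (F' t) B).
Proof.
move=> dF; have dB := derivative_on_cst I B.
apply: derivative_on_eq
  (derivative_onB (derivative_on_mulmx dF dB) (derivative_on_mulmx dB dF)) _.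
by move=> t _; rewrite mulmx0 mul0mx addr0 add0r.
Qed.

Lemma derivative_on_trform I (F F' : R -> 'M[R]_2) A :
  derivative_on I F F' ->
  derivative_on I (fun t => trform A (F t)) (fun t => trform A (F' t)).
Proof.
move=> dF; have dA := derivative_on_cst I A.
apply: derivative_on_eq (derivative_on_trace (derivative_on_mulmx dA dF)) _.
by move=> t _; rewrite mul0mx add0r.
Qed.

(** The bracket comes from the two exponential factors, which commute with
    [A]. *)
Lemma derivative_on_Ad I (F F' : R -> 'M[R]_2) A :
  derivative_on I F F' ->
  derivative_on I (fun t => Ad (expmx (t *: A)) (F t))
                  (fun t => Ad (expmx (t *: A)) (lie A (F t) + F' t)).
Proof.
move=> dF; rewrite /Ad; under eq_fun do rewrite invmx_expmx.
apply: derivative_on_eq (derivative_on_mulmx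
  (derivative_on_mulmx (derivative_on_expmx I A) dF)
  (derivative_on_expmxN I A)) _.
move=> t _; rewrite invmx_expmx.
have -> : expmx (- t *: A) *m A = A *m expmx (- t *: A) by exact: expmx_comm.
rewrite /lie !mulmxDr !mulmxDl !mulmxN !mulNmx !mulmxA -!addrA; congr (_ + _).
by rewrite addrC.
Qed.

End adjoint.

(** * The explicit flow and its uniqueness *)

Section flow.
Context (R : realType) (P X0 : 'M[R]_2).
Implicit Types (I : interval R) (t : R) (F Q : R -> 'M[R]_2).

Lemma Ad_expmxVK t Y : Ad (expmx (t *: P)) (Ad (expmx (- t *: P)) Y) = Y.
Proof. by rewrite Ad_mul ?expmx_unit// mul_expmxxN Ad1. Qed.

(** [Ad_{exp(-tP)} F] is conserved. *)
Lemma lie_flow_unique I F t :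
  derivative_on I F (fun s => lie P (F s)) -> 0 \in I -> t \in I ->
  F t = Ad (expmx (t *: P)) (F 0).
Proof.
move=> dF I0 It; rewrite -[LHS](Ad_expmxVK t); congr (Ad _ _).
pose U s := Ad (expmx (s *: (- P))) (F s).
have dU : derivative_on I U (fun=> 0).
  apply: derivative_on_eq (derivative_on_Ad (- P) dF) _ => s _.
  by rewrite lieNl addNr /Ad mulmx0 mul0mx.
have := @derivative_on0mx _ _ _ _ _ dU t 0 It I0.
by rewrite /U scale0r expmx0 Ad1 scalerN scaleNr.
Qed.

Let X t := Ad (expmx (t *: P)) X0.
Let g t := expmx (t *: (X0 + P)) *m expmx (- t *: P).
(** The inverse of [g]. *)
Let h t := expmx (t *: P) *m expmx (- t *: (X0 + P)).

Lemma derivative_on_X I : derivative_on I X (fun t => lie P (X t)).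
Proof.
apply: derivative_on_eq (derivative_on_Ad P (derivative_on_cst I X0)) _ => t _.
by rewrite addr0 Ad_lie ?expmx_unit// Ad_expmx_id.
Qed.

Lemma trform_X t : trform P (X t) = trform P X0.
Proof. by rewrite -[P in LHS](Ad_expmx_id P t) trform_Ad ?expmx_unit. Qed.

Lemma mul_gh t : g t *m h t = 1%:M.
Proof.
by rewrite /g /h mulmxA -(mulmxA (expmx _)) mul_expmxNx mulmx1 mul_expmxxN.
Qed.

Lemma mul_hg t : h t *m g t = 1%:M.
Proof. exact/mulmx1C/mul_gh. Qed.

Lemma g_unit t : g t \in unitmx.
Proof. exact: (mulmx1_unit (mul_gh t)).1. Qed.

Lemma derivative_on_g I : derivative_on I g (fun t => g t *m X t).
Proof.
apply: derivative_on_eq (derivative_on_mulmx (derivative_on_expmx I (X0 + P))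
  (derivative_on_expmxN I P)) _ => t _.
rewrite /g /X /Ad invmx_expmx.
have := expmx_comm (- t) (erefl (P *m P)); have := mul_expmxNx P t.
move: (expmx (t *: (X0 + P))) (expmx (t *: P)) (expmx (- t *: P)) => G E E'.
move=> EE EP; rewrite EP !mulmxA -(mulmxA G E') EE mulmx1.
by rewrite mulmxN mulmxA mulmxDr mulmxDl addrK.
Qed.

Lemma derivative_on_h I : derivative_on I h (fun t => - (X t *m h t)).
Proof.
apply: derivative_on_eq (derivative_on_mulmx (derivative_on_expmx I P)
  (derivative_on_expmxN I (X0 + P))) _ => t _.
rewrite /h /X /Ad invmx_expmx.
have := expmx_comm (- t) (erefl ((X0 + P) *m (X0 + P))).
have := mul_expmxNx P t.
move: (expmx (- t *: (X0 + P))) (expmx (t *: P)) (expmx (- t *: P)) => G E E'.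
move=> EE GY; rewrite GY !mulmxA -(mulmxA (E *m X0) E') EE mulmx1.
by rewrite mulmxN mulmxA mulmxDr mulmxDl opprD addrCA addrN addr0.
Qed.

(** [F g^-1] is conserved. *)
Lemma g_flow_unique I F t :
  derivative_on I F (fun s => F s *m X s) -> 0 \in I -> t \in I ->
  F 0 = 1%:M -> F t = g t.
Proof.
move=> dF I0 It F0; rewrite -[LHS]mulmx1 -(mul_hg t) mulmxA.
suff -> : F t *m h t = 1%:M by rewrite mul1mx.
have d0 : derivative_on I (fun s => F s *m h s) (fun=> 0).
  apply: derivative_on_eq (derivative_on_mulmx dF (derivative_on_h I)) _ => s _.
  by move: (F s) (X s) (h s) => f x k; rewrite mulmxN mulmxA addrN.
rewrite (@derivative_on0mx _ _ _ _ _ d0 t 0 It I0).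
by rewrite F0 /h oppr0 !scale0r expmx0 !mulmx1.
Qed.

Lemma derivative_on_L1 I L0 :
  derivative_on I (fun t => invmx (g t) *m L0 *m g t)
    (fun t => lie (invmx (g t) *m L0 *m g t) (X t)).
Proof.
have gE t : invmx (g t) = h t by exact/invmx_unique/mul_gh.
under [X in derivative_on _ X]eq_fun do rewrite gE.
apply: derivative_on_eq (derivative_on_mulmx (derivative_on_mulmx
  (derivative_on_h I) (derivative_on_cst I L0)) (derivative_on_g I)) _ => t _.
rewrite gE; move: (X t) (g t) (h t) => x k k'.
by rewrite /lie mulmx0 addr0 !mulNmx !mulmxA addrC.
Qed.

(** [g F g^-1] is conserved. *)
Lemma L1_flow_unique I F t :
  derivative_on I F (fun s => lie (F s) (X s)) -> 0 \in I -> t \in I ->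
  F t = invmx (g t) *m F 0 *m g t.
Proof.
move=> dF I0 It.
have d0 : derivative_on I (fun s => g s *m F s *m h s) (fun=> 0).
  apply: derivative_on_eq (derivative_on_mulmx (derivative_on_mulmx
    (derivative_on_g I) dF) (derivative_on_h I)) _ => s _.
  move: (X s) (g s) (h s) (F s) => x k k' f.
  rewrite /lie mulmxBr !mulmxN !mulmxA -!mulmxBl addrC.
  by rewrite [_ *m _ *m _ + _]addrC subrK addNr mul0mx.
have -> : F 0 = g t *m F t *m h t.
  rewrite (@derivative_on0mx _ _ _ _ _ d0 t 0 It I0).
  by rewrite /g /h oppr0 !scale0r expmx0 !mulmx1 mul1mx.
move: (g t) (h t) (mul_hg t) (g_unit t) => k k' k'k uk.
by rewrite !mulmxA mulVmx// mul1mx -mulmxA k'k mulmx1.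
Qed.

(** The equation satisfied by the difference of two solutions for [Lambda_R].
    Pairing it with [P] kills both brackets, so [<P, Q>] is conserved and the
    second term vanishes along [Q]. *)
Lemma LR_flow_unique I Q t :
  derivative_on I Q (fun s => lie P (Q s) - trform P (Q s) *: lie P (X s)) ->
  0 \in I -> t \in I -> Q 0 = 0 -> Q t = 0.
Proof.
move=> dQ I0 It Q0.
have trQ : {in I, forall s, trform P (Q s) = 0}.
  move=> s Is.
  have d0 : derivative_on I (fun s => trform P (Q s)) (fun=> 0).
    apply: derivative_on_eq (derivative_on_trform P dQ) _ => x _.
    by rewrite trformBr trformZr !trform_lie_self mulr0 subr0.
  rewrite (@derivative_on0 _ _ _ d0 s 0 Is I0) Q0.
  by rewrite /trform mulmx0 linear0.
have {}dQ : derivative_on I Q (fun s => lie P (Q s)).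
  by apply: derivative_on_eq dQ _ => s Is; rewrite trQ// scale0r subr0.
by rewrite (lie_flow_unique dQ I0 It) Q0 /Ad mulmx0 mul0mx.
Qed.

(** [M] stands for the pull-back of [Lambda_1 - (3/2) lambda_cost J] by
    [Ad_{exp(tP)}]. *)
Context (M : R -> 'M[R]_2) (LR0 : 'M[R]_2) (cM : continuous M).

Let LP := int0mx M.
Let ell := int0 (fun s => trform P (LR0 - lie (LP s) X0)).
Let S t := LR0 - lie (LP t + ell t *: P) X0.

Lemma derivative_on_LP I : derivative_on I LP M.
Proof. by apply: derivative_onT => t; exact: is_derive_int0mx. Qed.

(** The term [ell t *: P] of [S] drops out because [<P, [P, X0]> = 0]; hence
    [ell] is a primitive of [<P, S>]. *)
Lemma trform_S t : trform P (S t) = trform P (LR0 - lie (LP t) X0).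
Proof.
have -> : S t = LR0 - lie (LP t) X0 - ell t *: lie P X0.
  by rewrite /S lieDl lieZl opprD addrA.
by rewrite [LHS]trformBr trformZr trform_lie_self mulr0 subr0.
Qed.

Lemma derivative_on_S I :
  derivative_on I S (fun t => - lie (M t + trform P (S t) *: P) X0).
Proof.
apply: derivative_onT => t.
have dell (s : R) : is_derive s 1 ell (trform P (S s)).
  rewrite trform_S; apply: is_derive_int0 => x.
  apply: (is_derive_continuous (derivative_on_line (derivative_on_trform P
    (derivative_onB (derivative_on_cst _ LR0)
      (derivative_on_lie X0 (derivative_on_LP _)))))).
have dellP : derivative_on `]-oo, +oo[ (fun t => LP t + ell t *: P)
    (fun t => M t + trform P (S t) *: P).
  apply: derivative_onT => s; apply: is_deriveD; first exact: is_derive_int0mx.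
  apply/is_derive_mxP => i j.
  have -> : (fun x => (ell x *: P) i j) = P i j \*: ell.
    by apply/funext => x; rewrite mxE mulrC.
  by apply: is_derive_eq; rewrite mxE mulrC.
have := derivative_on_line (derivative_onB (derivative_on_cst _ LR0)
  (derivative_on_lie X0 dellP)).
by move=> /(_ t); rewrite sub0r.
Qed.

Lemma derivative_on_LR I : let LR t := Ad (expmx (t *: P)) (S t) in
  derivative_on I LR (fun t => lie P (LR t) - trform P (LR t) *: lie P (X t)
     - lie (Ad (expmx (t *: P)) (M t)) (X t)).
Proof.
move=> LR; apply: derivative_on_eq (derivative_on_Ad P (derivative_on_S I)) _.
move=> t _; have uE := expmx_unit P t.
have -> : trform P (LR t) = trform P (S t).
  by rewrite -[P in LHS](Ad_expmx_id P t) trform_Ad.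
rewrite AdD AdN !Ad_lie// AdD AdZ Ad_expmx_id -/(LR t) -/(X t).
by rewrite lieDl lieZl [_ + _ *: _]addrC opprD addrA.
Qed.

Lemma S_at0 : S 0 = LR0.
Proof.
by rewrite /S /ell /LP int00 int0mx0 scale0r addr0 /lie mul0mx mulmx0 !subr0.
Qed.

Lemma tr_S t : \tr (S t) = \tr LR0.
Proof. by rewrite linearB/= tr_lie subr0. Qed.

End flow.

(** * The state and costate equations *)

Theorem mainTheorem8 (R : realType) (lcost : R) (Zu X0 L10 LR0 : 'M[R]_2)
    (hlcost : lcost <= 0)
    (hZu : sl2 Zu) (hX0 : sl2 X0) (hL10 : sl2 L10) (hLR0 : sl2 LR0)
    (hZuX0 : trform Zu X0 != 0) :
  let P : 'M[R]_2 := (trform Zu X0)^-1 *: Zu in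
  let LP : R -> 'M[R]_2 := int0mx (fun s =>
    Ad (expmx (- s *: (X0 + P))) L10
    - (3 / 2 * lcost) *: Ad (expmx (- s *: P)) (J R)) in
  let ell : R -> R := int0 (fun s => trform P (LR0 - lie (LP s) X0)) in
  let S : R -> 'M[R]_2 := fun t => LR0 - lie (LP t + ell t *: P) X0 in
  let g : R -> 'M[R]_2 := fun t =>
    expmx (t *: (X0 + P)) *m expmx (- t *: P) in
  let X : R -> 'M[R]_2 := fun t => Ad (expmx (t *: P)) X0 in
  let L1 : R -> 'M[R]_2 := fun t => invmx (g t) *m L10 *m g t in
  let LR : R -> 'M[R]_2 := fun t => Ad (expmx (t *: P)) (S t) in
  state_costate_solution lcost Zu X0 L10 LR0 `]-oo, +oo[ g X L1 LR /\
  (forall (I : interval R) (g' X' L1' LR' : R -> 'M[R]_2),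
     0 \in I ->
     state_costate_solution lcost Zu X0 L10 LR0 I g' X' L1' LR' ->
     forall t : R, t \in I ->
       [/\ g' t = g t, X' t = X t, L1' t = L1 t & LR' t = LR t]).
Proof.
move=> P LP ell S g X L1 LR.
pose c := trform Zu X0.
pose M (s : R) : 'M[R]_2 := Ad (expmx (- s *: (X0 + P))) L10
  - (3 / 2 * lcost) *: Ad (expmx (- s *: P)) (J R).
have cM : continuous M.
  (* Scalars moved inside, so that M is a difference of adjoint flows. *)
  pose M' s := Ad (expmx (s *: (- (X0 + P)))) L10 -
    Ad (expmx (s *: (- P))) ((3 / 2 * lcost) *: J R).
  have -> : M = M'.
    by apply/funext => s; rewrite /M /M' !scaleNr !scalerN AdZ.
  exact: (is_derive_continuous (derivative_on_line
    (derivative_onB (derivative_on_Ad _ (derivative_on_cst _ _))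
      (derivative_on_Ad _ (derivative_on_cst _ _))))).
have ZuP : Zu = c *: P by rewrite /P scalerA mulfV// scale1r.
have trP : \tr P = 0 by rewrite /P mxtraceZ hZu mulr0.
have trY : \tr (X0 + P) = 0 by rewrite mxtraceD hX0 trP addr0.
have trformZu Y : trform Zu Y = c * trform P Y.
  by rewrite ZuP /trform -scalemxAl mxtraceZ.
have trPX0 : trform P X0 = 1.
  by apply: (mulfI hZuX0); rewrite -trformZu mulr1.
(* Since <P, X0> = 1, the control equation along X is X' = [P, X]. *)
have ZuX t : trform Zu (X t) = c by rewrite trformZu trform_X trPX0 mulr1.
have normalize Y : c^-1 *: lie Zu Y = lie P Y by rewrite -lieZl.
have trform_div Y : trform Y Zu / c = trform P Y.
  by rewrite trformC trformZu mulrC mulKf.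
have gSL t : \det (g t) = 1.
  by rewrite /g det_mulmx !det_expmx// mulr1.
have hgt t : invmx (g t) = expmx (t *: P) *m expmx (- t *: (X0 + P)).
  exact: invmx_unique (mul_gh P X0 t).
(* M is what Lambda_1 - (3/2) lambda_cost J becomes after pulling back by
   exp(tP), because exp(tP) exp(-t(X0 + P)) is the inverse of g. *)
have AdM t : Ad (expmx (t *: P)) (M t) = L1 t - (3 / 2 * lcost) *: J R.
  rewrite /M -AdZ AdD AdN Ad_expmxVK; congr (_ - _).
  by rewrite Ad_mul ?expmx_unit// /Ad (invmx_unique (mul_hg P X0 t)) /L1 hgt.
have dLR I : derivative_on I LR (fun t => lie P (LR t)
    - trform P (LR t) *: lie P (X t)
    + lie (- L1 t + (3 / 2 * lcost) *: J R) (X t)).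
  apply: derivative_on_eq (derivative_on_LR P X0 LR0 cM I) _ => t _.
  have -> : - L1 t + (3 / 2 * lcost) *: J R = - Ad (expmx (t *: P)) (M t).
    by rewrite AdM opprB addrC.
  by rewrite lieNl.
have S_0 : S 0 = LR0 by exact: S_at0.
have LR_0 : LR 0 = LR0 by rewrite /LR S_0 scale0r expmx0 Ad1.
split.
  have uE := expmx_unit P.
  have dX := derivative_on_X P X0 `]-oo, +oo[.
  have dg := derivative_on_g P X0 `]-oo, +oo[.
  have dL1 := derivative_on_L1 P X0 `]-oo, +oo[ L10.
  have E0 : expmx (0 *: P) = 1%:M by rewrite scale0r expmx0.
  have g0 : g 0 = 1%:M by rewrite /g oppr0 !scale0r expmx0 mulmx1.
  split=> [t _|t _|t _|t _|t _||||||||||||] //.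
  - by rewrite /sl2/= tr_Ad.
  - by rewrite /sl2/= mxtrace_mulC mulmxA mulmxV ?mul1mx// g_unit.
  - by rewrite /sl2/= tr_Ad// tr_S.
  - by rewrite ZuX.
  - exact: dg.1.
  - exact: dX.1.
  - exact: dL1.1.
  - exact: (dLR _).1.
  - exact: dg.2.
  - by move=> t It; rewrite ZuX normalize; exact: dX.2.
  - exact: dL1.2.
  - move=> t It; rewrite [trform (X t) Zu]trformC ZuX !normalize trform_div.
    by have [_ /(_ t It)] := dLR `]-oo, +oo[.
  - by rewrite /X E0 Ad1.
  - by rewrite /L1 g0 invmx1 mul1mx mulmx1.
move=> I g' X' L1' LR' I0.
move=> [_ _ _ _ _ cg cX cL1 cLR og oX oL1 oLR g'0 X0' L1'0 LR'0].
have dX1 : derivative_on I X' (fun t => (trform Zu (X' t))^-1 *: lie Zu (X' t)).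
  by split.
(* <Zu, X'> is conserved because <Zu, [Zu, X']> = 0. *)
have ZuX' : {in I, forall t, trform Zu (X' t) = c}.
  move=> t It; rewrite /c -X0'.
  apply: (@derivative_on0 _ I (fun s => trform Zu (X' s))) => //.
  apply: derivative_on_eq (derivative_on_trform Zu dX1) _ => s _.
  by rewrite trformZr trform_lie_self mulr0.
have X'X : {in I, forall t, X' t = X t}.
  move=> t It; rewrite /X -X0'; apply: (@lie_flow_unique _ P I) => //.
  by apply: derivative_on_eq dX1 _ => s Is; rewrite ZuX'// normalize.
have g'g : {in I, forall t, g' t = g t}.
  move=> t It; apply: (@g_flow_unique _ P X0 I) => //.
  apply: (@derivative_on_eq _ _ _ _ (fun t => g' t *m X' t)) => // s Is.
  by rewrite X'X.
have L1'L1 : {in I, forall t, L1' t = L1 t}.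
  move=> t It; rewrite /L1 -L1'0; apply: (@L1_flow_unique _ P X0 I) => //.
  apply: (@derivative_on_eq _ _ _ _ (fun t => lie (L1' t) (X' t))) => // s Is.
  by rewrite X'X.
move=> t It; rewrite X'X// g'g// L1'L1//; split=> //.
apply/eqP; rewrite -subr_eq0; apply/eqP.
apply: (@LR_flow_unique _ P X0 I (fun s => LR' s - LR s)) => //; last first.
  by rewrite LR'0 LR_0 subrr.
have dLR' : derivative_on I LR' (fun t => lie P (LR' t)
    - trform P (LR' t) *: lie P (X t)
    + lie (- L1 t + (3 / 2 * lcost) *: J R) (X t)).
  pose D t := (trform Zu (X' t))^-1 *: lie Zu (LR' t)
       - (trform (LR' t) Zu / trform (X' t) Zu)
           *: ((trform Zu (X' t))^-1 *: lie Zu (X' t))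
       + lie (- L1' t + (3 / 2 * lcost) *: J R) (X' t).
  apply: (@derivative_on_eq _ _ _ _ D) => // s Is.
  rewrite /D [trform (X' s) Zu]trformC ZuX'// !normalize trform_div.
  by rewrite X'X// L1'L1.
apply: derivative_on_eq (derivative_onB dLR' (dLR I)) _ => s Is.
rewrite opprD addrACA subrr addr0.
by rewrite lieBr trformBr scalerBl !opprD !opprK addrACA.
Qed.
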